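(* Let $n\geq 3$ be an integer, let $p$ be a prime with $p\equiv 1\pmod n$, let $\xi$ be a primitive $n$-th root of unity and let $K=\mathbb{Q}(\xi)$ be the $n$-th cyclotomic field, regarded as a subfield of $\mathbb{Q}_p$. Then there exists an integer $\alpha$ not divisible by $p$ such that $\alpha$ is not an $l$-th power residue modulo $p$ for every integer $l\geq 2$ dividing $n$. Moreover, for every such $\alpha$: (i) if $A$ is the symbol algebra $A=\left(\frac{\alpha,\,p}{K,\xi}\right)$, then $A\otimes_K\mathbb{Q}_p=\left(\frac{\alpha,\,p}{\mathbb{Q}_p,\xi}\right)$ is a non-split algebra over $\mathbb{Q}_p$; (ii) the symbol algebra $A$ is a non-split algebra over $K$.
   Context: Let $n\geq 3$, let $F$ be a field with characteristic not dividing $n$ (and $\neq 2$) containing a primitive $n$-th root of unity $\xi$, and let $a,b\in F^{*}$. The symbol algebra $\left(\frac{a,\,b}{F,\xi}\right)$ is the $F$-algebra generated by elements $x,y$ subject to $x^n=a$, $y^n=b$, $yx=\xi xy$; it is a central simple $F$-algebra of dimension $n^2$. It is called split if it is isomorphic to the matrix algebra $M_n(F)$. Since $p\equiv 1\pmod n$, $\mathbb{Q}_p$ contains the $n$-th roots of unity, so $\mathbb{Q}(\xi)$ embeds in $\mathbb{Q}_p$; one fixes such an embedding. *)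

(* Defs.v *)
From HB Require Import structures.
From mathcomp Require Import all_boot all_order all_algebra all_field.
From mathcomp Require Import boolp.

Set Implicit Arguments.
Unset Strict Implicit.
Unset Printing Implicit Defensive.

Import Order.TTheory GRing.Theory Num.Theory.
Local Open Scope ring_scope.
Local Open Scope quotient_scope.

(* MathComp's algType excludes the zero ring, which a presentation by           *)
(* generators and relations may produce; hence this variant, in which an        *)
(* R-algebra is a possibly zero ring A with a ring morphism from R to the       *)
(* centre of A. The product of c : R and u : A is ascalar c * u.                *)
HB.mixin Record PzRing_isAssocAlgebra (R : comPzRingType) A of GRing.PzRing A :=
  { ascalar : {rmorphism R -> A};
    ascalar_central : forall (c : R) (u : A), ascalar c * u = u * ascalar c }.

#[short(type="assocAlgType")]
HB.structure Definition AssocAlgebra (R : comPzRingType) :=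
  { A of GRing.PzRing A & PzRing_isAssocAlgebra R A }.

HB.instance Definition _ (R : comNzRingType) (n : nat) :=
  PzRing_isAssocAlgebra.Build R 'M[R]_n
    (ascalar := @scalar_mx R n : {rmorphism R -> 'M[R]_n})
    (fun c u => esym (scalar_mxC c u)).

Definition alg_iso (R : comPzRingType) (A B : assocAlgType R) : Prop :=
  exists2 f : {rmorphism A -> B},
    bijective f & forall c : R, f (ascalar c) = ascalar c.

Definition is_split (F : fieldType) (n : nat) (A : assocAlgType F) : Prop :=
  alg_iso A 'M[F]_n.

Section Presentation.
Variables (R : comPzRingType) (X : Type).

Inductive ncterm : Type :=
  | Gen of X
  | Cst of R
  | Sum of ncterm & ncterm
  | Mul of ncterm & ncterm.

HB.instance Definition _ := gen_eqMixin ncterm.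
HB.instance Definition _ := gen_choiceMixin ncterm.

Variable rel : ncterm -> ncterm -> Prop.

(* The least congruence containing rel and the axioms of R-algebras. *)
Inductive pcong : ncterm -> ncterm -> Prop :=
  | pc_rel s t : rel s t -> pcong s t
  | pc_refl s : pcong s s
  | pc_sym s t : pcong s t -> pcong t s
  | pc_trans s t u : pcong s t -> pcong t u -> pcong s u
  | pc_sum s s' t t' : pcong s s' -> pcong t t' -> pcong (Sum s t) (Sum s' t')
  | pc_mul s s' t t' : pcong s s' -> pcong t t' -> pcong (Mul s t) (Mul s' t')
  | pc_sumA s t u : pcong (Sum s (Sum t u)) (Sum (Sum s t) u)
  | pc_sumC s t : pcong (Sum s t) (Sum t s)
  | pc_sum0 s : pcong (Sum (Cst 0) s) s
  | pc_mulA s t u : pcong (Mul s (Mul t u)) (Mul (Mul s t) u)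
  | pc_mul1 s : pcong (Mul (Cst 1) s) s
  | pc_mulDl s t u : pcong (Mul (Sum s t) u) (Sum (Mul s u) (Mul t u))
  | pc_mulDr s t u : pcong (Mul s (Sum t u)) (Sum (Mul s t) (Mul s u))
  | pc_mul0 s : pcong (Mul (Cst 0) s) (Cst 0)
  | pc_cstD c d : pcong (Cst (c + d)) (Sum (Cst c) (Cst d))
  | pc_cstM c d : pcong (Cst (c * d)) (Mul (Cst c) (Cst d))
  | pc_cstC c s : pcong (Mul (Cst c) s) (Mul s (Cst c)).

Definition pcongb : ssrbool.rel ncterm := fun s t => `[< pcong s t >].

Lemma pcongb_refl : reflexive pcongb.
Proof. by move=> s; apply/asboolP; apply: pc_refl. Qed.

Lemma pcongb_sym : symmetric pcongb.
Proof. by move=> s t; apply/asboolP/asboolP; apply: pc_sym. Qed.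

Lemma pcongb_trans : transitive pcongb.
Proof.
move=> t s u /asboolP st /asboolP tu; apply/asboolP.
exact: pc_trans st tu.
Qed.

Canonical pcong_equiv := EquivRel pcongb pcongb_refl pcongb_sym pcongb_trans.

Definition presented_alg : Type := {eq_quot pcong_equiv}.

HB.instance Definition _ := EqQuotient.on presented_alg.
HB.instance Definition _ := Choice.on presented_alg.

Local Notation P := presented_alg.
Local Notation cls := (\pi_P).

Lemma pclsP (s t : ncterm) : cls s = cls t <-> pcong s t.
Proof.
split=> [/eqquotP /asboolP //|st].
by apply/eqquotP; apply/asboolP.
Qed.

Lemma pclsK (x : P) : cls (repr x) = x. Proof. exact: reprK. Qed.

Lemma prepr (s : ncterm) : pcong (repr (cls s)) s.
Proof. by apply/pclsP; rewrite pclsK. Qed.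

Definition padd (x y : P) : P := cls (Sum (repr x) (repr y)).
Definition pmul (x y : P) : P := cls (Mul (repr x) (repr y)).
Definition pcst (c : R) : P := cls (Cst c).
Definition popp (x : P) : P := pmul (pcst (-1)) x.

Lemma paddE s t : padd (cls s) (cls t) = cls (Sum s t).
Proof. by apply/pclsP; apply: pc_sum; apply: prepr. Qed.

Lemma pmulE s t : pmul (cls s) (cls t) = cls (Mul s t).
Proof. by apply/pclsP; apply: pc_mul; apply: prepr. Qed.

Lemma paddA : associative padd.
Proof.
elim/quotW=> s; elim/quotW=> t; elim/quotW=> u.
by rewrite (paddE t) (paddE s t) !paddE; apply/pclsP; apply: pc_sumA.
Qed.

Lemma paddC : commutative padd.
Proof.
by elim/quotW=> s; elim/quotW=> t; rewrite !paddE; apply/pclsP; apply: pc_sumC.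
Qed.

Lemma padd0 : left_id (pcst 0) padd.
Proof. by elim/quotW=> s; rewrite paddE; apply/pclsP; apply: pc_sum0. Qed.

Lemma pmulA : associative pmul.
Proof.
elim/quotW=> s; elim/quotW=> t; elim/quotW=> u.
by rewrite (pmulE t) (pmulE s t) !pmulE; apply/pclsP; apply: pc_mulA.
Qed.

Lemma pcstC c x : pmul (pcst c) x = pmul x (pcst c).
Proof. by elim/quotW: x => s; rewrite !pmulE; apply/pclsP; apply: pc_cstC. Qed.

Lemma pmul1r : left_id (pcst 1) pmul.
Proof. by elim/quotW=> s; rewrite pmulE; apply/pclsP; apply: pc_mul1. Qed.

Lemma pmulr1 : right_id (pcst 1) pmul.
Proof. by move=> x; rewrite -pcstC pmul1r. Qed.

Lemma pmulDl : left_distributive pmul padd.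
Proof.
elim/quotW=> s; elim/quotW=> t; elim/quotW=> u.
rewrite (paddE s) (pmulE s) (pmulE t) pmulE paddE.
by apply/pclsP; apply: pc_mulDl.
Qed.

Lemma pmulDr : right_distributive pmul padd.
Proof.
elim/quotW=> s; elim/quotW=> t; elim/quotW=> u.
rewrite (paddE t) (pmulE s t) (pmulE s u) pmulE paddE.
by apply/pclsP; apply: pc_mulDr.
Qed.

Lemma pcstD c d : pcst (c + d) = padd (pcst c) (pcst d).
Proof. by rewrite paddE; apply/pclsP; apply: pc_cstD. Qed.

Lemma pcstM c d : pcst (c * d) = pmul (pcst c) (pcst d).
Proof. by rewrite pmulE; apply/pclsP; apply: pc_cstM. Qed.

Lemma paddN : left_inverse (pcst 0) popp padd.
Proof.
move=> x; rewrite -[in X in padd _ X](pmul1r x) -pmulDl -pcstD addNr.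
by elim/quotW: x => s; rewrite pmulE; apply/pclsP; apply: pc_mul0.
Qed.

HB.instance Definition _ :=
  GRing.isZmodule.Build presented_alg paddA paddC padd0 paddN.

HB.instance Definition _ :=
  GRing.Zmodule_isPzRing.Build presented_alg pmulA pmul1r pmulr1 pmulDl pmulDr.

Lemma pcst_is_nmod : nmod_morphism pcst.
Proof. by split=> [|c d]; rewrite ?pcstD. Qed.

Lemma pcst_is_monoid : monoid_morphism pcst.
Proof. by split=> [|c d]; rewrite ?pcstM. Qed.

HB.instance Definition _ := GRing.isNmodMorphism.Build R P pcst pcst_is_nmod.
HB.instance Definition _ :=
  GRing.isMonoidMorphism.Build R P pcst pcst_is_monoid.

HB.instance Definition _ :=
  PzRing_isAssocAlgebra.Build R presented_alg
    (ascalar := pcst : {rmorphism R -> P}) pcstC.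

Definition pgen (x : X) : presented_alg := cls (Gen x).

End Presentation.

Arguments Gen {R X} _.
Arguments Cst {R X} _.

Fixpoint ncpow (R : comPzRingType) (X : Type) (t : ncterm R X) (n : nat) :
    ncterm R X :=
  if n is m.+1 then Mul t (ncpow t m) else Cst 1.

Section SymbolAlgebra.
Variables (F : fieldType) (n : nat) (xi a b : F).

Inductive symbol_gen : Type := SymX | SymY.

Local Notation x := (@Gen F symbol_gen SymX).
Local Notation y := (@Gen F symbol_gen SymY).

Inductive symbol_rel : ncterm F symbol_gen -> ncterm F symbol_gen -> Prop :=
  | symbol_xn : symbol_rel (ncpow x n) (Cst a)
  | symbol_yn : symbol_rel (ncpow y n) (Cst b)
  | symbol_yx : symbol_rel (Mul y x) (Mul (Cst xi) (Mul x y)).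

Definition symbol_alg : assocAlgType F := presented_alg symbol_rel.

End SymbolAlgebra.

(* The generator (u, l) stands for the pure tensor u (x) l of the L-algebra     *)
(* A (x)_K L, where L is a K-algebra through iota. Products of pure tensors     *)
(* are pure and Cst l is 1 (x) l, so the presented algebra is additively the    *)
(* group generated by the pure tensors subject to bilinearity and K-balance.    *)
Section ScalarExtension.
Variables (K L : fieldType) (iota : {rmorphism K -> L}) (A : assocAlgType K).

Local Notation tens u l := (@Gen L (A * L)%type (u, l)).

Inductive tensor_rel : ncterm L (A * L) -> ncterm L (A * L) -> Prop :=
  | tensorDl u v l : tensor_rel (tens (u + v) l) (Sum (tens u l) (tens v l))
  | tensorDr u l m : tensor_rel (tens u (l + m)) (Sum (tens u l) (tens u m))
  | tensorZ k u l : tensor_rel (tens (ascalar k * u) l) (tens u (iota k * l))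
  | tensorM u v l m : tensor_rel (Mul (tens u l) (tens v m))
                                 (tens (u * v) (l * m))
  | tensor1 l : tensor_rel (Cst l) (tens 1 l).

Definition scalar_ext : assocAlgType L := presented_alg tensor_rel.

End ScalarExtension.

(* Z_p as the inverse limit of the rings Z/p^k: the component u k is the        *)
(* residue in [0, p^k) of the p-adic integer modulo p^k.                        *)
Section PadicIntegers.
Variables (p : nat) (p_pr : prime p).

Local Notation q k := ((p ^ k)%N%:Z).

Definition coherent (u : nat -> int) : Prop :=
  forall k, u k = (u k.+1 %% q k)%Z.

Record padic_int : Type :=
  PadicInt { residue :> nat -> int; _ : `[< coherent residue >] }.

HB.instance Definition _ := [isSub for residue].
HB.instance Definition _ := [Choice of padic_int by <:].

Lemma padic_intP (u v : padic_int) : (forall k, u k = v k) -> u = v.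
Proof. by move=> uv; apply: val_inj; apply: funext. Qed.

Lemma residue_coherent (u : padic_int) k : u k = (u k.+1 %% q k)%Z.
Proof. by case: u => u /= /asboolP. Qed.

Lemma residue_mod (u : padic_int) k : (u k %% q k)%Z = u k.
Proof. by rewrite residue_coherent modz_mod. Qed.

Lemma modz_pow (x : int) k : ((x %% q k.+1)%Z %% q k)%Z = (x %% q k)%Z.
Proof.
apply/eqP; rewrite eqz_mod_dvd; apply: (@dvdz_trans (q k.+1)).
  by rewrite dvdzE /= dvdn_exp2l.
by rewrite -eqz_mod_dvd modz_mod.
Qed.

Lemma coherent_mod (f : nat -> int) :
  (forall k, f k = f k.+1 %[mod q k])%Z ->
  `[< coherent (fun k => (f k %% q k)%Z) >].
Proof. by move=> fE; apply/asboolP => k; rewrite modz_pow fE. Qed.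

Definition Zp_of f fE : padic_int := PadicInt (@coherent_mod f fE).

Lemma zp_cstE (c : int) k : (c = c %[mod q k])%Z. Proof. by []. Qed.

Lemma zp_addE (u v : padic_int) k :
  (u k + v k = u k.+1 + v k.+1 %[mod q k])%Z.
Proof. by rewrite [u k]residue_coherent [v k]residue_coherent modzDm. Qed.

Lemma zp_mulE (u v : padic_int) k :
  (u k * v k = u k.+1 * v k.+1 %[mod q k])%Z.
Proof. by rewrite [u k]residue_coherent [v k]residue_coherent modzMm. Qed.

Lemma zp_oppE (u : padic_int) k : (- u k = - u k.+1 %[mod q k])%Z.
Proof. by rewrite [u k]residue_coherent modzNm. Qed.

Definition zp_cst c := Zp_of (zp_cstE c).
Definition zp_add u v := Zp_of (zp_addE u v).
Definition zp_mul u v := Zp_of (zp_mulE u v).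
Definition zp_opp u := Zp_of (zp_oppE u).

Lemma zp_addA : associative zp_add.
Proof. by move=> u v w; apply: padic_intP => k /=; rewrite modzDml modzDmr addrA. Qed.

Lemma zp_addC : commutative zp_add.
Proof. by move=> u v; apply: padic_intP => k /=; rewrite addrC. Qed.

Lemma zp_add0 : left_id (zp_cst 0) zp_add.
Proof. by move=> u; apply: padic_intP => k /=; rewrite modzDml add0r residue_mod. Qed.

Lemma zp_addN : left_inverse (zp_cst 0) zp_opp zp_add.
Proof. by move=> u; apply: padic_intP => k /=; rewrite modzDml addNr. Qed.

HB.instance Definition _ :=
  GRing.isZmodule.Build padic_int zp_addA zp_addC zp_add0 zp_addN.

Lemma zp_mulA : associative zp_mul.
Proof. by move=> u v w; apply: padic_intP => k /=; rewrite modzMml modzMmr mulrA. Qed.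

Lemma zp_mulC : commutative zp_mul.
Proof. by move=> u v; apply: padic_intP => k /=; rewrite mulrC. Qed.

Lemma zp_mul1 : left_id (zp_cst 1) zp_mul.
Proof. by move=> u; apply: padic_intP => k /=; rewrite modzMml mul1r residue_mod. Qed.

Lemma zp_mulDl : left_distributive zp_mul zp_add.
Proof.
move=> u v w; apply: padic_intP => k /=.
by rewrite modzMml modzDm mulrDl.
Qed.

Lemma zp_1neq0 : zp_cst 1 != 0.
Proof.
apply/eqP=> /(congr1 (fun u : padic_int => u 1%N)) /=.
by rewrite expn1 mod0z modz_small //= ltz_nat prime_gt1.
Qed.

End PadicIntegers.

(* The dummy primality argument makes Z_p an integral domain by inference. *)
Definition padicZ (p : nat) (p_pr : prime p) : Type := padic_int p.

Section PadicDomain.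
Variables (p : nat) (p_pr : prime p).
Local Notation Z := (padicZ p_pr).
Local Notation q k := ((p ^ k)%N%:Z).

HB.instance Definition _ := GRing.Zmodule.on Z.
HB.instance Definition _ :=
  GRing.Zmodule_isComNzRing.Build Z (@zp_mulA p) (@zp_mulC p) (@zp_mul1 p)
    (@zp_mulDl p) (zp_1neq0 p_pr).

Definition zp_unit : {pred Z} := fun u => `[< exists v, v * u = 1 >].

Definition zp_inv (u : Z) : Z :=
  if pselect (exists v, v * u = 1) is left h then projT1 (cid h) else u.

Lemma zp_mulVx : {in zp_unit, left_inverse 1 zp_inv *%R}.
Proof.
move=> u /asboolP uU; rewrite /zp_inv.
by case: pselect => // h; case: cid.
Qed.

Lemma zp_unitPl (u v : Z) : v * u = 1 -> zp_unit u.
Proof. by move=> vu; apply/asboolP; exists v. Qed.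

Lemma zp_invr_out : {in [predC zp_unit], zp_inv =1 id}.
Proof.
move=> u uNU; rewrite /zp_inv; case: pselect => // h.
by move/negP: uNU; case; apply/asboolP.
Qed.

HB.instance Definition _ :=
  GRing.ComNzRing_hasMulInverse.Build Z zp_mulVx zp_unitPl zp_invr_out.

Lemma residue_dvd (u : padic_int p) i j : (q i %| u (i + j)%N)%Z -> u i = 0.
Proof.
elim: j => [|j IHj]; rewrite ?addn0 ?addnS => d.
  by rewrite -residue_mod; apply/dvdz_mod0P.
apply: IHj; rewrite residue_coherent [X in (_ %| X)%Z](_ : _ =
  u (i + j).+1 - (u (i + j).+1 %/ q (i + j))%Z * q (i + j)); last first.
  by rewrite {2}(divz_eq (u (i + j).+1) (q (i + j))) addrC addKr.
apply: rpredB => //; apply: dvdz_mull.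
by rewrite dvdzE /= dvdn_exp2l // leq_addr.
Qed.

Lemma zp_integral (u v : Z) : u * v = 0 -> (u == 0) || (v == 0).
Proof.
move=> uv0; apply/norP => -[/eqP u0 /eqP v0].
have [i ui] : exists i, u i <> 0.
  by apply: contrapT => /forallNP h; apply: u0; apply: padic_intP => k;
     rewrite [RHS]mod0z; apply: contrapT; apply: h.
have [j vj] : exists j, v j <> 0.
  by apply: contrapT => /forallNP h; apply: v0; apply: padic_intP => k;
     rewrite [RHS]mod0z; apply: contrapT; apply: h.
have uN : ~~ (p ^ i %| `|u (i + j)%N|)%N.
  by apply/negP => d; apply/ui/(@residue_dvd u i j); rewrite dvdzE.
have vN : ~~ (p ^ j %| `|v (i + j)%N|)%N.
  by apply/negP => d; apply/vj/(@residue_dvd v j i); rewrite addnC dvdzE.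
have /dvdz_mod0P : (u (i + j)%N * v (i + j)%N %% q (i + j))%Z = 0.
  have /(congr1 (fun w : padic_int p => w (i + j)%N)) := uv0.
  by rewrite /= mod0z.
rewrite dvdzE abszM /=.
have un0 : (0 < `|u (i + j)%N|)%N.
  by rewrite lt0n; apply: contraNneq uN => ->; rewrite dvdn0.
have vn0 : (0 < `|v (i + j)%N|)%N.
  by rewrite lt0n; apply: contraNneq vN => ->; rewrite dvdn0.
move: uN vN; rewrite !pfactor_dvdn ?muln_gt0 ?un0 // lognM // -!ltnNge.
move=> hu hv; rewrite leqNgt => /negP; apply.
by rewrite -addSn leq_add // ltnW.
Qed.

HB.instance Definition _ :=
  GRing.ComUnitRing_isIntegral.Build Z zp_integral.

End PadicDomain.

Definition Qp (p : nat) (p_pr : prime p) : fieldType := {fraction padicZ p_pr}.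

Definition power_residue (p l : nat) (alpha : int) : Prop :=
  exists x : int, (x ^+ l = alpha %[mod p])%Z.

(* Includes that alpha is not divisible by p. *)
Definition no_power_residue (p n : nat) (alpha : int) : Prop :=
  ~~ (p %| alpha)%Z /\
  forall l : nat, (2 <= l)%N -> (l %| n)%N -> ~ power_residue p l alpha.

(* Main.v *)
(* A splitting of (alpha, p) over a field F gives n x n matrices X, Y over F
   with X^n = alpha, Y^n = p and Y X = xi X Y; mapped to Q_p through an embedding
   of K, they contradict the following argument. If W is a d-dimensional subspace
   stable under a matrix T with T^n = alpha, the determinant x of T on W satisfies
   x^n = alpha^d; over F_p this forces n | d, because alpha is not an l-th power
   for any l >= 2 dividing n, and over Q_p as well, by reduction. Hence the vectors
   v X^i, i < n, form a basis of Q_p^n for every v != 0, and in that basis X is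
   integral. Write Y = p^k U (up to a unit) with U integral and nonzero modulo p;
   the kernel of U mod p is stable under X mod p, so it is zero and det U is a unit.
   Thus det Y has valuation n k, whereas Y^n = p says that it is 1.

   The embedding of K sends xi to a root of its minimal polynomial, which divides
   X^n - 1; the latter splits over Q_p by Teichmueller lifting. *)

From HB Require Import structures.
Require Import Defs.
From mathcomp Require Import all_boot all_order all_algebra all_field.
From mathcomp Require Import cyclic boolp ring.

Set Implicit Arguments.
Unset Strict Implicit.
Unset Printing Implicit Defensive.

Import Order.TTheory GRing.Theory Num.Theory.
Local Open Scope ring_scope.

(** * Presented algebras *)

Lemma alg_iso_sym (R : comPzRingType) (A B : assocAlgType R) :
  alg_iso A B -> alg_iso B A.
Proof.
case=> f [g fK gK] fc.
pose G : {rmorphism B -> A} := HB.pack g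
  (GRing.isZmodMorphism.Build _ _ g (can2_zmod_morphism fK gK))
  (GRing.isMonoidMorphism.Build _ _ g (can2_monoid_morphism fK gK)).
by exists G => [|c]; [exists f | rewrite -fc [LHS]fK].
Qed.

Lemma alg_iso_trans (R : comPzRingType) (A B C : assocAlgType R) :
  alg_iso A B -> alg_iso B C -> alg_iso A C.
Proof.
case=> f fB fc [g gB gc]; exists (g \o f) => [|c]; first exact: bij_comp.
by rewrite /= fc gc.
Qed.

Fixpoint nceval (R : comPzRingType) (X : Type) (B : pzRingType) (c : R -> B)
    (g : X -> B) (t : ncterm R X) : B :=
  match t with
  | Gen x => g x
  | Cst r => c r
  | Sum s t => nceval c g s + nceval c g t
  | Mul s t => nceval c g s * nceval c g t
  end.

Section UniversalProperty.
Local Open Scope quotient_scope.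
Variables (R : comPzRingType) (X : Type).
Variables (rel : ncterm R X -> ncterm R X -> Prop) (B : pzRingType).

Lemma nceval_ncpow (c : {rmorphism R -> B}) (g : X -> B) (t : ncterm R X) m :
  nceval c g (ncpow t m) = nceval c g t ^+ m.
Proof. by elim: m => [|m IHm] /=; rewrite ?rmorph1 // IHm exprS. Qed.

Lemma nceval_pcong (c : {rmorphism R -> B}) (g : X -> B) :
    (forall r b, c r * b = b * c r) ->
    (forall s t, rel s t -> nceval c g s = nceval c g t) ->
  forall s t, pcong rel s t -> nceval c g s = nceval c g t.
Proof.
move=> cC relP s t; elim=> {s t} //=; try by move=> *; congruence.
- by move=> *; rewrite addrA.
- by move=> *; rewrite addrC.
- by move=> *; rewrite rmorph0 add0r.
- by move=> *; rewrite mulrA.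
- by move=> *; rewrite rmorph1 mul1r.
- by move=> *; rewrite mulrDl.
- by move=> *; rewrite mulrDr.
- by move=> *; rewrite rmorph0 mul0r.
- by move=> *; rewrite rmorphD.
- by move=> *; rewrite rmorphM.
Qed.

(** Universal property: [f] evaluates a chosen representative, and by [nceval_pcong] the value
    depends only on its class. *)
Lemma presented_lift (c : {rmorphism R -> B}) (g : X -> B) :
    (forall r b, c r * b = b * c r) ->
    (forall s t, rel s t -> nceval c g s = nceval c g t) ->
  exists f : {rmorphism presented_alg rel -> B},
    (forall r, f (ascalar r) = c r) /\ (forall x, f (pgen rel x) = g x).
Proof.
move=> cC relP.
pose f (x : presented_alg rel) : B := nceval c g (repr x).
have fE s : f (\pi_(presented_alg rel) s) = nceval c g s.
  by apply: nceval_pcong => //; apply: prepr.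
have fD : nmod_morphism f.
  split=> [|x y]; first by rewrite [LHS]fE /= rmorph0.
  by rewrite [LHS]fE.
have fM : monoid_morphism f.
  split=> [|x y]; first by rewrite [LHS]fE /= rmorph1.
  by rewrite [LHS]fE.
pose F : {rmorphism presented_alg rel -> B} := HB.pack f
  (GRing.isNmodMorphism.Build _ _ f fD) (GRing.isMonoidMorphism.Build _ _ f fM).
by exists F; split=> [r|x]; rewrite [LHS]fE.
Qed.

Lemma presented_ext (f g : {rmorphism presented_alg rel -> B}) :
    (forall r, f (ascalar r) = g (ascalar r)) ->
    (forall x, f (pgen rel x) = g (pgen rel x)) ->
  f =1 g.
Proof.
move=> fg_cst fg_gen; elim/quotW; elim=> [x|r|s IHs t IHt|s IHs t IHt].
- exact: fg_gen.
- exact: fg_cst.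
- by rewrite -paddE [LHS](rmorphD f) [RHS](rmorphD g) IHs IHt.
- by rewrite -pmulE [LHS](rmorphM f) [RHS](rmorphM g) IHs IHt.
Qed.

Lemma pcls_nceval (t : ncterm R X) :
  \pi_(presented_alg rel) t = nceval (@ascalar _ (presented_alg rel)) (pgen rel) t.
Proof.
by elim: t => //= [s <- t <-|s <- t <-]; rewrite ?[_ + _]paddE ?[_ * _]pmulE.
Qed.

End UniversalProperty.

Lemma pgen_rel (R : comPzRingType) (X : Type)
    (rel : ncterm R X -> ncterm R X -> Prop) (s t : ncterm R X) :
  rel s t ->
  nceval (@ascalar _ (presented_alg rel)) (pgen rel) s =
    nceval (@ascalar _ (presented_alg rel)) (pgen rel) t.
Proof. by move=> st; rewrite -!pcls_nceval; apply/pclsP/pc_rel. Qed.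

(** * Symbol algebras and their scalar extensions *)

Definition symbol_triple (F : fieldType) (B : pzRingType) (c : F -> B)
    (n : nat) (xi a b : F) (u v : B) : Prop :=
  [/\ u ^+ n = c a, v ^+ n = c b & v * u = c xi * (u * v)].

Definition gensym (B : Type) (u v : B) (s : symbol_gen) : B :=
  if s is SymX then u else v.

Section Symbol.
Variables (F : fieldType) (n : nat) (xi a b : F).
Local Notation S := (symbol_alg n xi a b).
Local Notation gen := (pgen (@symbol_rel F n xi a b)).

Lemma symbol_gensP :
  symbol_triple (@ascalar _ S) n xi a b (gen SymX) (gen SymY).
Proof.
split; [move: (pgen_rel (symbol_xn n xi a b))|
        move: (pgen_rel (symbol_yn n xi a b))|
        exact: (pgen_rel (symbol_yx n xi a b))]; by rewrite nceval_ncpow.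
Qed.

Lemma symbol_lift (B : pzRingType) (c : {rmorphism F -> B}) (u v : B) :
    (forall r w, c r * w = w * c r) -> symbol_triple c n xi a b u v ->
  exists f : {rmorphism S -> B},
    [/\ forall r, f (ascalar r) = c r, f (gen SymX) = u & f (gen SymY) = v].
Proof.
move=> cC [un vn vu].
have [|f [fc fg]] := @presented_lift _ _ (@symbol_rel F n xi a b) B c (gensym u v) cC.
  by move=> s t []; rewrite ?nceval_ncpow.
by exists f; split=> //; rewrite fg.
Qed.

End Symbol.

Lemma symbol_triple_morph (F : fieldType) (B C : pzRingType) (c : F -> B)
    (f : {rmorphism B -> C}) n (xi a b : F) (u v : B) :
  symbol_triple c n xi a b u v ->
  symbol_triple (f \o c) n xi a b (f u) (f v).
Proof.
by case=> un vn vu; split; rewrite /= -?un -?vn ?rmorphXn // -!rmorphM vu.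
Qed.

(** The matrices are the images of the two generators; the isomorphism fixes scalars, so the
    defining relations persist. *)
Lemma split_symbol_triple (F : fieldType) n (xi a b : F) :
  is_split n (symbol_alg n xi a b) ->
  exists X Y : 'M[F]_n, symbol_triple scalar_mx n xi a b X Y.
Proof.
case=> f _ fc; have [xn yn yx] := symbol_triple_morph f (symbol_gensP n xi a b).
exists (f (pgen _ SymX)), (f (pgen _ SymY)).
by split; [rewrite [LHS]xn|rewrite [LHS]yn|rewrite [LHS]yx]; rewrite /= fc.
Qed.

Section ScalarExt.
Variables (K L : fieldType) (iota : {rmorphism K -> L}) (n : nat) (xi a b : K).
Local Notation A := (symbol_alg n xi a b).
Local Notation AL := (symbol_alg n (iota xi) (iota a) (iota b)).
Local Notation E := (scalar_ext iota A).
Local Notation tens u l := (pgen (@tensor_rel K L iota A) (u, l)).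

(** The two universal properties give inverse maps: [phi] sends the tensor of u and l to [theta u]
    times l, and [psi] sends each generator g to the tensor of g and 1. *)
Lemma scalar_ext_symbol : alg_iso E AL.
Proof.
have AL_C (r : L) (w : AL) : ascalar r * w = w * ascalar r by apply: ascalar_central.
have E_C (r : L) (w : E) : ascalar r * w = w * ascalar r by apply: ascalar_central.
pose rel := @tensor_rel K L iota A.
have tDl (u v : A) (l : L) : tens (u + v) l = tens u l + tens v l.
  exact: pgen_rel (tensorDl iota u v l).
have tDr (u : A) (l m : L) : tens u (l + m) = tens u l + tens u m.
  exact: pgen_rel (tensorDr iota u l m).
have tZ k (u : A) (l : L) : tens (ascalar k * u) l = tens u (iota k * l).
  exact: pgen_rel (tensorZ iota k u l).
have tM (u v : A) (l m : L) : tens u l * tens v m = tens (u * v) (l * m).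
  exact: pgen_rel (tensorM iota u v l m).
have t1 (l : L) : ascalar l = tens 1 l.
  exact: pgen_rel (tensor1 iota A l).
have [theta [thc thx thy]] : exists f : {rmorphism A -> AL},
    [/\ forall r, f (ascalar r) = ascalar (iota r),
        f (pgen _ SymX) = pgen _ SymX & f (pgen _ SymY) = pgen _ SymY].
  apply: (@symbol_lift _ _ _ _ _ _ (@ascalar _ AL \o iota)) => //.
    by move=> r w; apply: AL_C.
  by have [] := symbol_gensP n (iota xi) (iota a) (iota b).
have [phi [phc phg]] : exists f : {rmorphism E -> AL},
    (forall r, f (ascalar r) = ascalar r) /\
    (forall x : A * L, f (pgen rel x) = theta x.1 * ascalar x.2).
  apply: presented_lift => // s t [u v l|u l m|k u l|u v l m|l] /=.
  - by rewrite rmorphD mulrDl.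
  - by rewrite rmorphD mulrDr.
  - by rewrite [in LHS]rmorphM thc rmorphM mulrA [_ * theta u]AL_C.
  - rewrite !rmorphM -!mulrA; congr (_ * _).
    by rewrite !mulrA [_ * theta v]AL_C.
  - by rewrite rmorph1 mul1r.
have j_nmod : nmod_morphism (fun u : A => tens u 1 : E).
  split=> [|u v]; last exact: tDl.
  by apply: (@addrI E (tens 0 1)); rewrite -tDl !addr0.
have j_monoid : monoid_morphism (fun u : A => tens u 1 : E).
  by split=> [|u v]; rewrite ?tM ?mulr1 // -t1 rmorph1.
pose j : {rmorphism A -> E} := HB.pack (fun u : A => tens u 1 : E)
  (GRing.isNmodMorphism.Build _ _ _ j_nmod)
  (GRing.isMonoidMorphism.Build _ _ _ j_monoid).
have jc k : j (ascalar k) = ascalar (iota k).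
  by rewrite t1 -[ascalar k]mulr1 [LHS]tZ mulr1.
have [psi [psc psx psy]] : exists f : {rmorphism AL -> E},
    [/\ forall r, f (ascalar r) = ascalar r,
        f (pgen _ SymX) = j (pgen _ SymX) & f (pgen _ SymY) = j (pgen _ SymY)].
  apply: symbol_lift => //.
  have [xn yn yx] := symbol_triple_morph j (symbol_gensP n xi a b).
  split; [exact: etrans xn (jc a)|exact: etrans yn (jc b)|].
  by apply: etrans yx _; congr (_ * _); apply: jc.
(* The extension is generated by tensors of arbitrary [u] in [A], so [psi] has to be known on the
   image of all of [A]. *)
have psth : psi \o theta =1 j.
  apply: presented_ext => [r|[]] /=; first by rewrite thc psc -jc.
    by rewrite thx psx.
  by rewrite thy psy.
exists phi => //; exists psi.
- apply: (@presented_ext _ _ _ _ (psi \o phi) idfun) => [r|[u l]] /=.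
    by rewrite phc psc.
  rewrite phg /= rmorphM psc; have /= -> := psth u.
  by rewrite t1 tM mulr1 mul1r.
- apply: (@presented_ext _ _ _ _ (phi \o psi) idfun) => [r|[]] /=.
  + by rewrite psc phc.
  + by rewrite psx phg /= rmorph1 mulr1 thx.
  + by rewrite psy phg /= rmorph1 mulr1 thy.
Qed.

End ScalarExt.

(** * Matrices over discretely valued fields *)

Lemma det_scalar_root (F : fieldType) m (A : 'M[F]_m) n (a : F) :
  A ^+ n = a%:M -> (\det A) ^+ n = a ^+ m.
Proof.
move=> An; rewrite -(det_scalar m a) -An; elim: n {An} => [|n IHn]; first by rewrite det1.
by rewrite exprS IHn exprS -mulmxE det_mulmx.
Qed.

(** On a basis of [W], [A] acts by a matrix [C] whose n-th power is the scalar a; its determinant is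
    the required root. *)
Lemma stable_root (F : fieldType) m k (A : 'M[F]_m) (W : 'M[F]_(k, m)) n (a : F) :
  A ^+ n = a%:M -> (W *m A <= W)%MS -> exists d : F, d ^+ n = a ^+ \rank W.
Proof.
move=> An WA; have /submxP[C CE] : (row_base W *m A <= row_base W)%MS.
  by rewrite eq_row_base (submx_trans _ WA) // submxMr // eq_row_base.
exists (\det C); apply: det_scalar_root.
apply: (row_free_inj (row_base_free W)).
have CnE j : C ^+ j *m row_base W = row_base W *m A ^+ j.
  elim: j => [|j IHj]; first by rewrite mul1mx mulmx1.
  by rewrite exprSr -mulmxE -mulmxA -CE mulmxA IHj exprSr -mulmxE -mulmxA.
by rewrite CnE An mul_mx_scalar mul_scalar_mx.
Qed.

Section Valuation.
(** The model is a discrete valuation ring [R] with uniformizer [pi], fraction field [F] and residue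
    field [k]; nonzero reduction plays the role of being a unit. *)
Variables (R : idomainType) (F k : fieldType).
Variables (emb : {rmorphism R -> F}) (red : {rmorphism R -> k}) (pi : R).
Hypothesis emb_inj : injective emb.
Hypothesis embP : forall x : F, exists N D : R, D != 0 /\ x * emb D = emb N.
Hypothesis pi_neq0 : pi != 0.
Hypothesis red_pi : red pi = 0.
Hypothesis factorP : forall u : R, u != 0 ->
  exists i w, u = pi ^+ i * w /\ red w != 0.

Lemma emb_eq0 u : (emb u == 0) = (u == 0).
Proof. by rewrite -[in RHS](inj_eq emb_inj) rmorph0. Qed.

Lemma red_neq0 u : red u != 0 -> u != 0.
Proof. by apply: contra_neq => ->; rewrite rmorph0. Qed.

Lemma valuation_uniq i j a b : red a != 0 -> red b != 0 ->
  pi ^+ i * a = pi ^+ j * b -> i = j.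
Proof.
wlog ij : i j a b / (i <= j)%N.
  move=> IH a0 b0 ab; have [ij|/ltnW ij] := leqP i j.
    exact: IH ij a0 b0 ab.
  by rewrite (IH _ _ _ _ ij b0 a0 (esym ab)).
move=> a0 _; rewrite -(subnK ij) addnC exprD -mulrA.
move=> /(mulfI (expf_neq0 i pi_neq0)) aE; move: a0; rewrite aE rmorphM rmorphXn red_pi.
by rewrite expr0n; case: (j - i)%N => [|m]; rewrite ?addn0 //= mul0r eqxx.
Qed.

(** Write x = N/D and extract powers i and j of [pi] from N and D: comparing valuations in N^n = c
    D^n gives i = j, so these powers cancel in x. *)
Lemma unit_of_root (x : F) n c : (0 < n)%N -> red c != 0 -> x ^+ n = emb c ->
  exists A B, [/\ red A != 0, red B != 0 & x * emb B = emb A].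
Proof.
move=> n0 c0 xn; have [N [D [D0 xD]]] := embP x.
have NE : N ^+ n = c * D ^+ n.
  by apply: emb_inj; rewrite rmorphXn -xD exprMn xn rmorphM rmorphXn.
have N0 : N != 0.
  apply/eqP => N0; move/eqP: NE; rewrite N0 expr0n gtn_eqF //= eq_sym mulf_eq0.
  by rewrite (negPf (red_neq0 c0)) (negPf (expf_neq0 n D0)).
have [i [A [NA A0]]] := factorP N0; have [j [B [DB B0]]] := factorP D0.
exists A, B; split=> //.
have : pi ^+ (i * n) * A ^+ n = pi ^+ (j * n) * (c * B ^+ n).
  by rewrite mulrCA !exprM -!exprMn -NA -DB.
move=> /valuation_uniq; rewrite rmorphM !rmorphXn mulf_neq0 ?expf_neq0 //.
move=> /(_ isT isT)/eqP; rewrite eqn_pmul2r // => /eqP ij.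
have pi0 : emb (pi ^+ i) != 0 by rewrite emb_eq0 expf_neq0.
by apply: (mulfI pi0); rewrite mulrCA -!rmorphM -NA ij -DB.
Qed.

Lemma common_denominator (I : finType) (f : I -> F) :
  exists D (g : I -> R), D != 0 /\ forall i, f i * emb D = emb (g i).
Proof.
have /fin_all_exists[N] : forall i, exists N D : R, D != 0 /\ f i * emb D = emb N.
  by move=> i; apply: embP.
move=> /fin_all_exists[D ND]; exists (\prod_i D i).
exists (fun i => N i * \prod_(j | j != i) D j); split=> [|i].
  by apply/prodf_neq0 => i _; have [] := ND i.
by rewrite (bigD1 i) //= !rmorphM mulrA; have [_ ->] := ND i.
Qed.

Lemma red_eq0P u : red u = 0 -> exists v, u = pi * v.
Proof.
have [->|u0] := eqVneq u 0; first by exists 0; rewrite mulr0.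
have [[|i] [w [uE w0]]] := factorP u0.
  by move: w0; rewrite uE mul1r => /eqP.
by exists (pi ^+ i * w); rewrite uE exprS mulrA.
Qed.

(** Induction on the valuation of a fixed nonzero entry: as long as all entries reduce to zero,
    dividing the matrix by [pi] lowers this valuation. *)
Lemma mx_factor m n (U : 'M[R]_(m, n)) : U != 0 ->
  exists i (V : 'M[R]_(m, n)), U = pi ^+ i *: V /\ map_mx red V != 0.
Proof.
move=> U0; have [a [b Uab]] : exists a b, U a b != 0.
  have [[a b] /= Uab|UZ] := pickP (fun ab : 'I_m * 'I_n => U ab.1 ab.2 != 0).
    by exists a, b.
  case/eqP: U0; apply/matrixP => a b; rewrite mxE; apply/eqP.
  by have /negbFE := UZ (a, b).
have [j [w [UE w0]]] := factorP Uab.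
elim: j U {U0 Uab} UE => [|j IHj] U UE.
  exists 0%N, U; rewrite scale1r; split=> //; apply/eqP => /matrixP/(_ a b).
  by rewrite !mxE UE mul1r => /eqP; rewrite (negPf w0).
have [Ur0|Ur0] := eqVneq (map_mx red U) 0; last first.
  by exists 0%N, U; rewrite scale1r.
have /fin_all_exists[V VE] : forall ij : 'I_m * 'I_n, exists v, U ij.1 ij.2 = pi * v.
  by move=> ij; apply: red_eq0P; have /matrixP/(_ ij.1 ij.2) := Ur0; rewrite !mxE.
have UV : U = pi *: \matrix_(i, j) V (i, j).
  by apply/matrixP => i l; rewrite !mxE -VE.
have [|i [V' [V'E V'0]]] := IHj (\matrix_(i, j) V (i, j)).
  apply: (mulfI pi_neq0); rewrite mulrA -exprS -UE.
  by move: (VE (a, b)); rewrite mxE.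
by exists i.+1, V'; split=> //; rewrite UV V'E scalerA -exprS.
Qed.

Lemma map_emb_inj m n : injective (map_mx emb : 'M_(m, n) -> 'M_(m, n)).
Proof.
by move=> A B /matrixP AB; apply/matrixP=> i j; have:= AB i j; rewrite !mxE => /emb_inj.
Qed.

Section NonSplit.
Variables (n : nat) (c : R).
Hypothesis n_gt1 : (1 < n)%N.
Hypothesis c_unit : red c != 0.
(** Supplied for F_p by [Fp_root_dvd]; it makes the dimension of every stable subspace a multiple of
    n. *)
Hypothesis c_root : forall d (x : k), x ^+ n = red c ^+ d -> (n %| d)%N.

Lemma stable_rank_red m l (A : 'M[k]_m) (W : 'M_(l, m)) :
  A ^+ n = (red c)%:M -> (W *m A <= W)%MS -> (n %| \rank W)%N.
Proof. by move=> An /(stable_root An)[d /c_root]. Qed.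

(** The determinant on [W] is an n-th root of a unit, hence a quotient of elements with nonzero
    reduction, and its equation descends to the residue field. *)
Lemma stable_rank_emb m l (A : 'M[F]_m) (W : 'M_(l, m)) :
  A ^+ n = (emb c)%:M -> (W *m A <= W)%MS -> (n %| \rank W)%N.
Proof.
move=> An /(stable_root An)[d]; rewrite -rmorphXn => dn.
have cr0 : red (c ^+ \rank W) != 0 by rewrite rmorphXn expf_neq0.
have [A' [B [A0 B0 dE]]] := unit_of_root (ltnW n_gt1) cr0 dn.
apply: (c_root (x := red A' / red B)); rewrite expr_div_n.
apply: (canLR (mulfK (expf_neq0 n B0))); rewrite -!rmorphXn -rmorphM; congr (red _).
by apply: emb_inj; rewrite rmorphXn -dE exprMn dn -rmorphXn -rmorphM.
Qed.

(** The rows v X^i, i < n, of [W] form a basis in which X becomes the companion matrix [T] of t^n -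
    c, with entries in [R]. *)
Lemma integral_model (X : 'M[F]_n) : X ^+ n = (emb c)%:M ->
  exists (W : 'M[F]_n) (T : 'M[R]_n),
    [/\ W \in unitmx, W *m X = map_mx emb T *m W & T ^+ n = c%:M].
Proof.
move=> Xn; have n0 := ltnW n_gt1.
pose v : 'rV[F]_n := const_mx 1.
pose W := \matrix_(i < n) (v *m X ^+ i).
have /fin_all_exists[t tE] : forall i, exists t : 'rV[R]_n,
    row i (W *m X) = map_mx emb t *m W.
  move=> i; rewrite row_mul rowK -mulmxA mulmxE -exprSr.
  have [lt_in|le_ni] := ltnP i.+1 n.
    exists (delta_mx 0 (Ordinal lt_in)).
    by rewrite map_delta_mx -rowE rowK.
  have -> : i.+1 = n by apply/eqP; rewrite eqn_leq ltn_ord.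
  exists (c *: delta_mx 0 (Ordinal n0)).
  by rewrite map_mxZ map_delta_mx -scalemxAl -rowE rowK mulmx1 Xn mul_mx_scalar.
pose T : 'M[R]_n := \matrix_i t i.
have WX : W *m X = map_mx emb T *m W.
  by apply/row_matrixP => i; rewrite tE row_mul -map_row rowK.
(* The row space of [W] is stable under X and contains v, so its dimension is a nonzero multiple of
   n, hence n. *)
have W_unit : W \in unitmx.
  have nW : (n %| \rank W)%N by apply: (stable_rank_emb Xn); rewrite WX submxMl.
  have W0 : (0 < \rank W)%N.
    rewrite lt0n mxrank_eq0; apply/eqP => /(congr1 (row (Ordinal n0))).
    rewrite rowK mulmx1 row0 => /rowP/(_ (Ordinal n0))/eqP.
    by rewrite !mxE oner_eq0.
  rewrite -row_free_unit /row_free eqn_leq rank_leq_row.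
  exact: dvdn_leq nW.
exists W, T; split=> //; apply: map_emb_inj.
apply: (can_inj (mulmxK W_unit)).
have TnE j : map_mx emb (T ^+ j) *m W = W *m X ^+ j.
  elim: j => [|j IHj]; first by rewrite map_mx1 mul1mx mulmx1.
  by rewrite exprS -mulmxE map_mxM -mulmxA IHj mulmxA -WX exprS -mulmxE mulmxA.
by rewrite TnE Xn map_scalar_mx mul_mx_scalar mul_scalar_mx.
Qed.

(** In the basis of [integral_model], Y is a scalar multiple of an integral matrix with invertible
    reduction, so det Y has valuation divisible by n; but Y^n = pi makes it 1. *)
Lemma no_symbol_triple (z : F) (X Y : 'M[F]_n) : z ^+ n = 1 ->
  X ^+ n = (emb c)%:M -> Y ^+ n = (emb pi)%:M -> Y *m X = z *: (X *m Y) -> False.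
Proof.
move=> zn Xn Yn YX; have n0 := ltnW n_gt1.
(* As a root of unity, [z] is a quotient A/B of elements with nonzero reduction, so the commutation
   relation can be reduced. *)
have [||A [B [A0 B0 zE]]] := @unit_of_root z n 1 n0; rewrite ?rmorph1 ?oner_eq0 //.
have [W [T [Wu WX Tn]]] := integral_model Xn.
pose Y' := W *m Y *m invmx W.
have Y'T : Y' *m map_mx emb T = z *: (map_mx emb T *m Y').
  have TE : map_mx emb T = W *m X *m invmx W by rewrite WX mulmxK.
  by rewrite TE /Y' !mulmxA !mulmxKV // -(mulmxA W) YX -scalemxAr -scalemxAl !mulmxA.
have detY' : (\det Y') ^+ n = emb (pi ^+ n).
  rewrite rmorphXn -(det_scalar_root Yn) /Y' !det_mulmx mulrAC -det_mulmx mulmxV //.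
  by rewrite det1 mul1r.
have [D [g [D0 gE]]] := common_denominator (fun ij : 'I_n * 'I_n => Y' ij.1 ij.2).
pose U : 'M[R]_n := \matrix_(i, j) g (i, j).
have UE : emb D *: Y' = map_mx emb U.
  by apply/matrixP => i j; rewrite [LHS]mxE [RHS]mxE [U i j]mxE -gE mulrC.
have detU : D ^+ (n * n) * pi ^+ n = (\det U) ^+ n.
  apply: emb_inj; rewrite rmorphM -detY' !rmorphXn -det_map_mx -UE detZ exprMn.
  by rewrite exprM.
have U0 : U != 0.
  apply/eqP => U0; move/eqP: detU.
  have -> : \det U = 0 by rewrite U0 -(scale0r 1%:M) detZ expr0n gtn_eqF // mul0r.
  by rewrite expr0n gtn_eqF // mulf_eq0 !expf_eq0 (negPf D0) (negPf pi_neq0) !andbF.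
have [i [V [UV V0]]] := mx_factor U0.
(* [V] is a scalar multiple of Y' and inherits its relation with [T], written without
   denominators. *)
have VT : B *: (V *m T) = A *: (T *m V).
  apply: map_emb_inj; rewrite !map_mxZ !map_mxM.
  have pi0 : emb (pi ^+ i) != 0 by rewrite emb_eq0 expf_neq0.
  have UE' : emb (pi ^+ i) *: map_mx emb V = emb D *: Y' by rewrite -map_mxZ -UV.
  have VTE : emb (pi ^+ i) *: (map_mx emb V *m map_mx emb T) =
             emb D *: (Y' *m map_mx emb T) by rewrite scalemxAl UE' -scalemxAl.
  have TVE : emb (pi ^+ i) *: (map_mx emb T *m map_mx emb V) =
             emb D *: (map_mx emb T *m Y') by rewrite scalemxAr UE' -scalemxAr.
  apply: (scalerI pi0); rewrite !scalerA ![emb (pi ^+ i) * _]mulrC -!scalerA VTE TVE.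
  by rewrite Y'T -zE !scalerA; congr (_ *: _); rewrite [z * _]mulrC -!mulrA (mulrC z).
pose Vr := map_mx red V; pose Tr := map_mx red T.
have VTr : red B *: (Vr *m Tr) = red A *: (Tr *m Vr).
  by rewrite -!map_mxM -!map_mxZ VT.
(* If a row vector u satisfies u Vr = 0, then u Tr Vr is a multiple of u Vr Tr = 0. *)
have K_stable : (kermx Vr *m Tr <= kermx Vr)%MS.
  apply/sub_kermxP; apply: (scalerI A0); rewrite scaler0 -mulmxA scalemxAr -VTr.
  by rewrite -scalemxAr mulmxA mulmx_ker mul0mx scaler0.
have Trn : Tr ^+ n = (red c)%:M.
  by rewrite -map_scalar_mx -Tn rmorphXn.
(* The kernel of [Vr] has dimension divisible by n and, since [Vr] is nonzero, less than n; it is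
   zero. *)
have detV0 : red (\det V) != 0.
  rewrite -det_map_mx -unitfE -[_ \is a _]/(Vr \in unitmx) -row_free_unit.
  have := stable_rank_red Trn K_stable; rewrite mxrank_ker => /dvdn_leq n_le.
  rewrite /row_free eqn_leq rank_leq_row /= leqNgt; apply/negP => ltV.
  have := n_le; rewrite subn_gt0 => /(_ ltV).
  rewrite leqNgt ltn_subrL n0 andbT lt0n mxrank_eq0.
  by rewrite V0.
have [j [w [DE w0]]] := factorP D0.
have : pi ^+ (j * (n * n) + n) * w ^+ (n * n) = pi ^+ (i * (n * n)) * (\det V) ^+ n.
  by rewrite exprD mulrAC exprM -exprMn -DE detU UV detZ exprMn -!exprM.
move=> /valuation_uniq; rewrite !rmorphXn !expf_neq0 // => /(_ isT isT) jni.
(* The exponents satisfy j n^2 + n = i n^2, so j n + 1 = i n, impossible modulo n > 1. *)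
have : ((j * n).+1 * n == i * n * n)%N by rewrite mulSn addnC -!mulnA jni.
rewrite eqn_pmul2r // => /eqP/(congr1 (modn^~ n)).
by rewrite -addn1 modnMDl modnMl modn_small.
Qed.

End NonSplit.
End Valuation.

(** * Power residues *)

Section FiniteField.
Variables (p : nat) (p_pr : prime p).

Lemma Fp_expp (x : 'F_p) : x ^+ p = x.
Proof. by have := expf_card x; rewrite card_Fp. Qed.

Lemma Fp_fermat (x : 'F_p) : x != 0 -> x ^+ p.-1 = 1.
Proof.
by move=> x0; apply: (mulfI x0); rewrite -exprS prednK ?prime_gt0 // mulr1 Fp_expp.
Qed.

(** The p - 1 nonzero elements are all (p - 1)-th roots of unity, and that many distinct ones
    include a primitive one. *)
Lemma Fp_generator : exists z : 'F_p, p.-1.-primitive_root z.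
Proof.
have p1 : (0 < p.-1)%N by rewrite -subn1 subn_gt0 prime_gt1.
pose rs := [seq x <- enum 'F_p | x != 0].
have /(has_prim_root p1) : all (p.-1).-unity_root rs.
  apply/allP => x; rewrite mem_filter => /andP[x0 _].
  by apply/unity_rootP/Fp_fermat.
case/(_ _ _)/hasP.
- by rewrite filter_uniq ?enum_uniq.
- rewrite size_filter -(leq_add2r 1) addn1 prednK ?prime_gt0 //.
  rewrite -[X in (X <= _)%N](card_Fp p_pr) cardE.
  rewrite -(count_predC (fun x : 'F_p => x != 0)) leq_add2l.
  rewrite (eq_count (a2 := pred1 (0 : 'F_p))); last by move=> x /=; rewrite negbK.
  by rewrite -/(count_mem _ _) count_uniq_mem ?enum_uniq // leq_b1.
- by move=> z _ zP; exists z.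
Qed.

Lemma Fp_generated (z x : 'F_p) :
  p.-1.-primitive_root z -> x != 0 -> exists i : nat, x = z ^+ i.
Proof.
by move=> zP /Fp_fermat/(prim_rootP zP)[i ->]; exists i.
Qed.

(** Write a = z^s and x = z^t for a generator z. As n divides p - 1, the equation gives n | s d.
    With g = gcd(s, n), a is the g-th power of z^(s/g), so g = 1 and n | d. *)
Lemma Fp_root_dvd n d (a x : 'F_p) : (0 < n)%N -> (n %| p.-1)%N -> a != 0 ->
    (forall l, (2 <= l)%N -> (l %| n)%N -> forall y : 'F_p, y ^+ l <> a) ->
  x ^+ n = a ^+ d -> (n %| d)%N.
Proof.
move=> n0 np a0 aP xn; have [z zP] := Fp_generator.
have x0 : x != 0.
  by apply: contra_eq_neq xn => ->; rewrite expr0n gtn_eqF // eq_sym expf_neq0.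
have [t xE] := Fp_generated zP x0; have [s aE] := Fp_generated zP a0.
have ns : (n %| s * d)%N.
  have: (t * n == s * d %[mod p.-1])%N.
    by rewrite -(eq_prim_root_expr zP) !exprM -xE -aE xn.
  move=> /eqP/(congr1 (modn^~ n)); rewrite !modn_dvdm // modnMl => h.
  by rewrite /dvdn -h.
rewrite -(Gauss_dvdr d (m := n) (n := s)) //.
have g0 : (0 < gcdn s n)%N by rewrite gcdn_gt0 n0 orbT.
rewrite coprime_sym /coprime eqn_leq g0 andbT leqNgt; apply/negP => g1.
apply: (aP _ g1 (dvdn_gcdr _ _) (z ^+ (s %/ gcdn s n))).
by rewrite -exprM divnK ?dvdn_gcdl.
Qed.

Lemma Fp_int_eq0 (c : int) : (c%:~R == 0 :> 'F_p) = (p %| c)%Z.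
Proof.
rewrite [c in LHS]intEsign rmorphM rmorph_sign mulf_eq0 signr_eq0 /=.
by rewrite -(dvdn_pcharf (pchar_Fp p_pr)) dvdzE.
Qed.

Lemma Fp_intP (a b : int) : (a%:~R == b%:~R :> 'F_p) = (a == b %[mod p])%Z.
Proof. by rewrite -subr_eq0 -rmorphB Fp_int_eq0 eqz_mod_dvd. Qed.

Lemma Fp_int (x : 'F_p) : exists a : int, x = a%:~R.
Proof. by exists (val x : nat)%:Z; rewrite -[LHS]natr_Zp -pmulrn. Qed.

Lemma no_power_residueP n (alpha : int) : no_power_residue p n alpha ->
  alpha%:~R != 0 :> 'F_p /\
  forall l, (2 <= l)%N -> (l %| n)%N -> forall y : 'F_p, y ^+ l <> alpha%:~R.
Proof.
case=> pa aP; split=> [|l l2 ln y].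
  by rewrite Fp_int_eq0.
have [c ->] := Fp_int y => ya; apply: (aP l l2 ln); exists c.
by apply/eqP; rewrite -Fp_intP rmorphXn ya.
Qed.

(** An integer reducing to a generator z works: z = c^l with l >= 2 dividing p - 1 would give
    z^((p-1)/l) = 1, contrary to the order of z. *)
Lemma exists_no_power_residue n : (n %| p.-1)%N ->
  exists alpha : int, no_power_residue p n alpha.
Proof.
move=> np; have [z zP] := Fp_generator; have [a zE] := Fp_int z; exists a.
have p1 : (0 < p.-1)%N by rewrite -subn1 subn_gt0 prime_gt1.
have z0 : z != 0.
  apply/eqP => z0; have /eqP := prim_expr_order zP.
  by rewrite z0 expr0n gtn_eqF //= eq_sym oner_eq0.
split=> [|l l2 ln [c ca]].
  by rewrite -Fp_int_eq0 -zE.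
have {ca} cz : (c%:~R : 'F_p) ^+ l = z by apply/eqP; rewrite zE -rmorphXn Fp_intP ca.
have lp := dvdn_trans ln np.
have c0 : c%:~R != 0 :> 'F_p.
  by apply: contraTneq z0 => c0; rewrite -cz c0 expr0n gtn_eqF ?eqxx // ltnW.
have : (p.-1 %| p.-1 %/ l)%N.
  by rewrite (prim_order_dvd zP) -cz -exprM mulnC divnK // Fp_fermat.
have lp0 : (0 < p.-1 %/ l)%N by rewrite divn_gt0 ?(dvdn_leq p1) // ltnW.
by move=> /(dvdn_leq lp0); rewrite leqNgt ltn_Pdiv.
Qed.
End FiniteField.

(** * The p-adic numbers *)

Lemma frac_num_den (R : idomainType) (x : {fraction R}) :
  exists N D : R, D != 0 /\ x * FracField.tofrac D = FracField.tofrac N.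
Proof.
elim/quotW: x => r; exists (frac r).1, (frac r).2; split; first exact: denom_ratioP.
unlock FracField.tofrac; rewrite -[LHS]FracField.pi_mul; apply/eqmodP.
rewrite /= FracField.equivfE /FracField.mulf.
by rewrite !numden_Ratio ?mulf_neq0 ?oner_neq0 ?denom_ratioP // !mulr1 mulrC.
Qed.

Section Padic.
Variables (p : nat) (p_pr : prime p).
Local Notation Z := (padicZ p_pr).
Local Notation q k := ((p ^ k)%N%:Z).
Implicit Types u v w : Z.

Definition zp_res (u : Z) (k : nat) : int := residue u k.

Lemma zp_resP u v : (forall k, zp_res u k = zp_res v k) -> u = v.
Proof. exact: padic_intP. Qed.

Lemma zp_res_coherent u k : zp_res u k = (zp_res u k.+1 %% q k)%Z.
Proof. exact: residue_coherent. Qed.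

Lemma zp_res_mod u k : (zp_res u k %% q k)%Z = zp_res u k.
Proof. exact: residue_mod. Qed.

Lemma zp_res0 k : zp_res 0 k = 0. Proof. exact: mod0z. Qed.

Lemma zp_res1 k : zp_res 1 k = (1 %% q k)%Z. Proof. by []. Qed.

Lemma zp_resD u v k : zp_res (u + v) k = ((zp_res u k + zp_res v k) %% q k)%Z.
Proof. by []. Qed.

Lemma zp_resM u v k : zp_res (u * v) k = ((zp_res u k * zp_res v k) %% q k)%Z.
Proof. by []. Qed.

Lemma zp_res_nat m k : zp_res m%:R k = (m%:Z %% q k)%Z.
Proof.
elim: m => [|m IHm]; first by rewrite zp_res0 mod0z.
by rewrite -[m.+1]addn1 natrD zp_resD IHm zp_res1 modzDm PoszD.
Qed.

Lemma zp_resX u m k : zp_res (u ^+ m) k = (zp_res u k ^+ m %% q k)%Z.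
Proof.
elim: m => [|m IHm]; first by rewrite zp_res1.
by rewrite exprS zp_resM IHm modzMmr exprS.
Qed.

Lemma zp_p_neq0 : p%:R != 0 :> Z.
Proof.
apply/eqP => /(congr1 (zp_res^~ 2%N)); rewrite zp_res_nat zp_res0 modz_small.
  by move/eqP; rewrite eqz_nat gtn_eqF // prime_gt0.
by rewrite lez_nat leq0n ltz_nat -[X in (X < _)%N]expn1 ltn_exp2l // prime_gt1.
Qed.

Lemma zp_char0 m : m%:R = 0 :> Z -> m = 0%N.
Proof.
move=> /(congr1 (zp_res^~ m)); rewrite zp_res_nat zp_res0 modz_small.
  by case.
by rewrite lez_nat leq0n ltz_nat ltn_expl // prime_gt1.
Qed.

Definition zp_red (u : Z) : 'F_p := (zp_res u 1)%:~R.

Lemma Fp_int_mod (c : int) : ((c %% q 1)%Z)%:~R = c%:~R :> 'F_p.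
Proof. by apply/eqP; rewrite Fp_intP // expn1 modz_mod. Qed.

Lemma zp_red_nmod : nmod_morphism zp_red.
Proof.
split=> [|u v]; first by rewrite /zp_red zp_res0.
by rewrite /zp_red zp_resD Fp_int_mod rmorphD.
Qed.

Lemma zp_red_monoid : monoid_morphism zp_red.
Proof.
split=> [|u v]; first by rewrite /zp_red zp_res1 Fp_int_mod.
by rewrite /zp_red zp_resM Fp_int_mod rmorphM.
Qed.

HB.instance Definition _ := GRing.isNmodMorphism.Build Z 'F_p zp_red zp_red_nmod.
HB.instance Definition _ :=
  GRing.isMonoidMorphism.Build Z 'F_p zp_red zp_red_monoid.

Lemma zp_red_p : zp_red p%:R = 0.
Proof. by rewrite rmorph_nat pchar_Fp_0. Qed.

Lemma zp_mulp_res u k : zp_res (p%:R * u) k.+1 = p%:Z * zp_res u k.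
Proof.
rewrite zp_resM zp_res_nat modzMml [in RHS]zp_res_coherent.
rewrite mulz_modr ?ltz_nat ?prime_gt0 //.
by rewrite -PoszM -expnS.
Qed.

(** By coherence p divides every residue; the residue modulo p^(k+1), divided by p, is the residue
    of [w] modulo p^k. *)
Lemma zp_red_eq0 u : zp_red u = 0 -> exists w, u = p%:R * w.
Proof.
move/eqP; rewrite Fp_int_eq0 // => pu1.
have pu k : (p %| zp_res u k.+1)%Z.
  elim: k => // k IHk; rewrite (divz_eq (zp_res u k.+2) (q k.+1)) -zp_res_coherent.
  by rewrite rpredD // dvdz_mull // dvdzE /= dvdn_exp.
have p0 : 0 < p%:Z by rewrite ltz_nat prime_gt0.
have wE k : ((zp_res u k.+1 %/ p)%Z * p)%Z = zp_res u k.+1 by rewrite divzK.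
have w_coh : coherent p (fun k => (zp_res u k.+1 %/ p)%Z).
  move=> k; apply: (mulIf (lt0r_neq0 p0)); rewrite wE.
  by rewrite mulz_modl // wE -PoszM mulnC -expnS -zp_res_coherent.
exists (@PadicInt p _ (asboolT w_coh)); apply: zp_resP => -[|k].
  by rewrite -zp_res_mod -[RHS]zp_res_mod !modz1.
by rewrite zp_mulp_res mulrC [RHS]wE.
Qed.

(** Induction on the index of a nonzero residue: dividing by p shifts the residues down by one. *)
Lemma zp_factor u : u != 0 -> exists i w, u = p%:R ^+ i * w /\ zp_red w != 0.
Proof.
move=> u0; have [k uk] : exists k, zp_res u k != 0.
  apply: contrapT => /forallNP h; case/eqP: u0; apply: zp_resP => k.
  by rewrite zp_res0; apply/eqP/negPn/negP/h.
elim: k u uk {u0} => [|k IHk] u uk; first by rewrite -zp_res_mod modz1 in uk.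
have [/eqP u1|u1] := boolP (zp_red u == 0); last by exists 0%N, u; rewrite mul1r.
have [v uE] := zp_red_eq0 u1.
have [|i [w [vE w0]]] := IHk v.
  by apply: contra uk => /eqP vk; rewrite uE zp_mulp_res vk mulr0.
by exists i.+1, w; rewrite uE vE mulrA exprS.
Qed.

(** By induction: if c = d modulo p^(k+1), the cofactor of c - d in c^p - d^p is a sum of p terms
    congruent to d^(p-1) modulo p, which yields one more factor p. *)
Lemma pow_lift (a b : int) k : (p %| a - b)%Z ->
  (q k.+1 %| a ^+ (p ^ k) - b ^+ (p ^ k))%Z.
Proof.
move=> ab; elim: k => [|k IHk]; first by rewrite expn1 expn0 !expr1.
have pq : (p %| q k.+1)%Z by rewrite dvdzE /= dvdn_exp.
move: IHk; rewrite [(p ^ k.+1)%N in X in _ -> X]expnSr !exprM.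
move: (a ^+ _) (b ^+ _) => c d cd; rewrite subrXX expnSr PoszM dvdz_mul //.
rewrite -eqz_mod_dvd in cd.
have {}cd : c%:~R = d%:~R :> 'F_p.
  by apply/eqP; rewrite Fp_intP // eqz_mod_dvd (dvdz_trans pq) // -eqz_mod_dvd.
rewrite -Fp_int_eq0 // rmorph_sum (eq_bigr (fun=> d%:~R ^+ p.-1)) => [|i _].
  by rewrite sumr_const card_ord -mulr_natl pchar_Fp_0 // mul0r.
rewrite rmorphM !rmorphXn /= cd -exprD subnK //.
by rewrite -ltnS prednK ?prime_gt0.
Qed.

(** For an integer lift g of x, the powers g^(p^k) modulo p^k are coherent and define the
    Teichmueller representative w. As g^n = 1 modulo p, [pow_lift] gives w^n = 1. *)
Lemma zp_teichmuller n (x : 'F_p) : x ^+ n = 1 ->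
  exists w : Z, w ^+ n = 1 /\ zp_red w = x.
Proof.
move=> xn.
have [g xE] := Fp_int x.
have w_coh k : (g ^+ (p ^ k) = g ^+ (p ^ k.+1) %[mod q k])%Z.
  apply/eqP; rewrite eqz_mod_dvd expnS exprM.
  apply: (@dvdz_trans (q k.+1)); first by rewrite dvdzE /= dvdn_exp2l.
  apply: pow_lift; rewrite -eqz_mod_dvd -Fp_intP // rmorphXn /= -xE.
  by rewrite Fp_expp.
exists (Zp_of w_coh); split.
  apply: zp_resP => k; rewrite zp_resX zp_res1; apply/eqP.
  rewrite -[zp_res _ _]/((g ^+ (p ^ k) %% q k)%Z) modzXm -exprM mulnC exprM.
  rewrite -[X in _ == (X %% _)%Z](expr1n int (p ^ k)) eqz_mod_dvd.
  apply: (@dvdz_trans (q k.+1)); first by rewrite dvdzE /= dvdn_exp2l.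
  by apply: pow_lift; rewrite -eqz_mod_dvd -Fp_intP // rmorphXn /= -xE xn.
rewrite /zp_red -[zp_res _ _]/((g ^+ (p ^ 1) %% q 1)%Z) Fp_int_mod rmorphXn /= -xE.
by rewrite expn1 Fp_expp.
Qed.

End Padic.

(** * Embedding a cyclotomic field in a field of characteristic zero *)

Section CyclotomicEmbedding.
Variable L : fieldType.
Hypothesis L_char0 : forall m : nat, m%:R = 0 :> L -> m = 0%N.

Lemma char0_intr_eq0 (c : int) : (c%:~R == 0 :> L) = (c == 0).
Proof.
rewrite [c in LHS]intEsign rmorphM rmorph_sign mulf_eq0 signr_eq0 /=.
by apply/eqP/eqP => [/L_char0/eqP|->//]; rewrite absz_eq0 => /eqP.
Qed.

Lemma char0_ratr (x : rat) (m d : int) : x * d%:~R = m%:~R ->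
  ratr x * d%:~R = m%:~R :> L.
Proof.
move=> xdm; have dx0 : (denq x)%:~R != 0 :> L by rewrite char0_intr_eq0 denq_neq0.
apply: (mulIf dx0); rewrite mulrAC divfK // -!rmorphM; congr _%:~R.
by apply/eqP; rewrite -(eqr_int rat) !rmorphM /= numqE -xdm mulrAC.
Qed.

(** The morphism is [ratr]; its laws are checked after multiplying by denominators, which are
    nonzero in characteristic zero. *)
Lemma char0_rat_morph : inhabited {rmorphism rat -> L}.
Proof.
have dP (x : rat) : (denq x)%:~R != 0 :> L by rewrite char0_intr_eq0 denq_neq0.
have nP (x : rat) : ratr x * (denq x)%:~R = (numq x)%:~R :> L by rewrite divfK.
have rB : zmod_morphism (@ratr L).
  move=> x y; apply: (mulIf (mulf_neq0 (dP x) (dP y))).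
  have -> : (ratr x - ratr y) * ((denq x)%:~R * (denq y)%:~R) =
      (numq x * denq y - numq y * denq x)%:~R :> L.
    by rewrite rmorphB !rmorphM /= -!nP; ring.
  rewrite -rmorphM.
  by apply: char0_ratr; rewrite rmorphB !rmorphM /= !numqE; ring.
have rM : monoid_morphism (@ratr L).
  split=> [|x y]; first by rewrite -[LHS]mulr1; apply: (@char0_ratr 1 1 1).
  apply: (mulIf (mulf_neq0 (dP x) (dP y))).
  rewrite [RHS]mulrACA !nP -!rmorphM /=.
  by apply: char0_ratr; rewrite !rmorphM /= !numqE; ring.
pose r : {rmorphism rat -> L} := HB.pack (@ratr L)
  (GRing.isZmodMorphism.Build _ _ _ rB) (GRing.isMonoidMorphism.Build _ _ _ rM).
by constructor.
Qed.

(** The minimal polynomial m of xi divides X^n - 1, which over L is the product of the X - omega^i;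
    hence m has a root zeta in L, and evaluating polynomials in xi at zeta is a morphism. *)
Lemma cyclotomic_embedding (K : fieldExtType rat) (xi : K) (omega : L) n :
    xi ^+ n = 1 -> <<1; xi>>%VS = fullv -> n.-primitive_root omega ->
  inhabited {rmorphism K -> L}.
Proof.
move=> xin xi_gen omegaP; have [r] := char0_rat_morph.
have n0 := prim_order_gt0 omegaP.
pose inK := map_poly (in_alg K); pose inL := map_poly r.
have /polyOver1P[m mE] : minPoly 1 xi \is a polyOver 1%VS by apply: minPolyOver.
have m_dvd (s : {poly rat}) : root (inK s) xi -> m %| s.
  rewrite -(dvdp_map (in_alg K)) -mE; apply: minPoly_dvdp.
  by apply/polyOver1P; exists s.
have [zeta zetaP] : exists zeta, root (inL m) zeta.
  have : inL m %| \prod_(0 <= i < n) ('X - (omega ^+ i)%:P).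
    have XnE : inL ('X^n - 1) = 'X^n - 1 by rewrite /inL rmorphB rmorph1 /= map_polyXn.
    rewrite (factor_Xn_sub_1 omegaP) -XnE dvdp_map m_dvd //.
    by rewrite /inK rmorphB rmorph1 /= map_polyXn rootE !hornerE xin subrr.
  case/dvdp_prod_XsubC => b; case: (mask _ _) => [|i s].
    (* An empty product would make m constant, but a minimal polynomial has positive degree. *)
    rewrite big_nil -size_poly_eq1 size_map_poly -(size_map_poly (in_alg K)) -mE.
    by rewrite size_minPoly.
  rewrite big_cons => mE'; exists (omega ^+ i).
  by rewrite (eqp_root mE') rootM root_XsubC eqxx.
have eval_eq (s t : {poly rat}) :
    (inK s).[xi] = (inK t).[xi] -> (inL s).[zeta] = (inL t).[zeta].
  move/eqP; rewrite -subr_eq0 -hornerN -hornerD -rmorphB => /m_dvd st.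
  have /dvdpP[u uE] : inL m %| inL s - inL t by rewrite -rmorphB dvdp_map.
  by apply/eqP; rewrite -subr_eq0 -hornerN -hornerD uE -rootE rootM zetaP orbT.
(* [h] chooses a polynomial for each element; by [eval_eq] the value at zeta does not depend on the
   choice. *)
have /choice[h hE] : forall y : K, exists s : {poly rat}, (inK s).[xi] = y.
  move=> y; have /Fadjoin_polyP[s /polyOver1P[t ->] yE] : y \in <<1; xi>>%VS.
    by rewrite xi_gen memvf.
  by exists t.
pose f y := (inL (h y)).[zeta].
have f_nmod : nmod_morphism f.
  split=> [|x y].
    rewrite -[RHS](horner0 zeta) -(rmorph0 inL).
    by apply: eval_eq; rewrite hE /inK rmorph0 horner0.
  by rewrite -hornerD -rmorphD; apply: eval_eq; rewrite /inK rmorphD hornerD !hE.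
have f_monoid : monoid_morphism f.
  split=> [|x y].
    rewrite -[RHS](hornerC 1 zeta) -[1%:P](rmorph1 inL).
    by apply: eval_eq; rewrite hE /inK rmorph1 hornerC.
  by rewrite -hornerM -rmorphM; apply: eval_eq; rewrite /inK rmorphM hornerM !hE.
pose F : {rmorphism K -> L} := HB.pack f
  (GRing.isNmodMorphism.Build _ _ f f_nmod)
  (GRing.isMonoidMorphism.Build _ _ f f_monoid).
by constructor.
Qed.
End CyclotomicEmbedding.

(** * Symbol algebras over the p-adic numbers *)

Section PadicSymbol.
Variables (p : nat) (p_pr : prime p).
Local Notation emb :=
  (@FracField.tofrac (padicZ p_pr) : {rmorphism padicZ p_pr -> Qp p_pr}).

Lemma Qp_char0 m : m%:R = 0 :> Qp p_pr -> m = 0%N.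
Proof.
rewrite -(rmorph_nat emb) => /eqP; rewrite [_ == _]tofrac_eq0 => /eqP.
exact: zp_char0.
Qed.

(** The lift w of an element of order n in F_p satisfies w^n = 1, so its order divides n; reduction
    modulo p shows that n divides this order. *)
Lemma Qp_prim_root n : (n %| p.-1)%N -> exists z : Qp p_pr, n.-primitive_root z.
Proof.
move=> np; have [g gP] := Fp_generator p_pr.
have xP := dvdn_prim_root gP np; set x := g ^+ _ in xP.
have n0 := prim_order_gt0 xP.
have [w [wn wx]] := zp_teichmuller p_pr (prim_expr_order xP); exists (emb w).
have [|m mP mn] := @prim_order_exists _ n (emb w) n0.
  by rewrite -rmorphXn wn rmorph1.
suff nm : (n %| m)%N by rewrite (_ : n = m) //; apply/eqP; rewrite eqn_dvd nm mn.
rewrite (prim_order_dvd xP) -wx -rmorphXn.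
have /eqP := prim_expr_order mP.
by rewrite -rmorphXn -(rmorph1 emb) [_ == _]tofrac_eq => /eqP ->; rewrite rmorph1.
Qed.

(** The valuation argument for Z_p, with residue field F_p, uniformizer p and c = alpha. *)
Lemma Qp_no_symbol_triple n (alpha : int) (z : Qp p_pr) (X Y : 'M[Qp p_pr]_n) :
    (1 < n)%N -> (n %| p.-1)%N -> no_power_residue p n alpha -> z ^+ n = 1 ->
  ~ symbol_triple scalar_mx n z alpha%:~R p%:R X Y.
Proof.
move=> n1 np /(no_power_residueP p_pr)[a0 aP] zn [Xn Yn YX].
have red_alpha : zp_red (alpha%:~R : padicZ p_pr) = alpha%:~R by rewrite rmorph_int.
apply: (@no_symbol_triple _ _ _ emb (@zp_red p p_pr) p%:R _ _ _ _ _
  n alpha%:~R n1 _ _ z X Y zn).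
- by move=> u v /eqP; rewrite [_ == _]tofrac_eq => /eqP.
- exact: frac_num_den.
- exact: zp_p_neq0.
- exact: zp_red_p.
- exact: zp_factor.
- by move: a0; rewrite -red_alpha.
- move=> d x; have := @Fp_root_dvd _ p_pr n d _ x (ltnW n1) np a0 aP.
  by rewrite -red_alpha.
- by rewrite rmorph_int.
- by rewrite rmorph_nat.
- by rewrite -mul_scalar_mx.
Qed.

End PadicSymbol.

Theorem theorem4p1 (n p : nat) (p_pr : prime p) (K : fieldExtType rat) (xi : K) :
  (3 <= n)%N ->
  p = 1 %[mod n] ->
  n.-primitive_root xi ->
  <<1; xi>>%VS = fullv ->
  [/\ inhabited {rmorphism K -> Qp p_pr},
      exists alpha : int, no_power_residue p n alpha
    & forall alpha : int, no_power_residue p n alpha ->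
      (forall iota : {rmorphism K -> Qp p_pr},
          alg_iso (scalar_ext iota (symbol_alg n xi alpha%:~R p%:R))
                  (symbol_alg n (iota xi) alpha%:~R p%:R)
          /\ ~ is_split n (scalar_ext iota (symbol_alg n xi alpha%:~R p%:R)))
      /\ ~ is_split n (symbol_alg n xi alpha%:~R p%:R)].
Proof.
move=> n3 p1 xiP xi_gen; have n1 : (1 < n)%N by apply: leq_trans n3.
have np : (n %| p.-1)%N.
  by rewrite -subn1 -eqn_mod_dvd ?prime_gt0 //; apply/eqP.
have xin := prim_expr_order xiP.
have K_emb : inhabited {rmorphism K -> Qp p_pr}.
  have [z zP] := Qp_prim_root p_pr np.
  exact: cyclotomic_embedding (@Qp_char0 _ p_pr) _ _ _ _ xin xi_gen zP.
split=> //; first exact: exists_no_power_residue.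
move=> alpha alphaP.
have iota_xin (iota : {rmorphism K -> Qp p_pr}) : iota xi ^+ n = 1.
  by rewrite -rmorphXn xin rmorph1.
split=> [iota|].
  have ext_iso := scalar_ext_symbol iota n xi alpha%:~R p%:R.
  rewrite rmorph_int rmorph_nat in ext_iso; split=> // ext_split.
  have [X [Y XY]] := split_symbol_triple (alg_iso_trans (alg_iso_sym ext_iso) ext_split).
  exact: Qp_no_symbol_triple n1 np alphaP (iota_xin iota) XY.
(* A splitting over K gives matrices over K; mapped entrywise to Q_p, they satisfy the relations
   just excluded. *)
have [iota] := K_emb => /split_symbol_triple[X [Y]].
move=> /(symbol_triple_morph (map_mx iota : {rmorphism 'M_n -> 'M_n}))[Xn Yn YX].
apply: (Qp_no_symbol_triple (X := map_mx iota X) (Y := map_mx iota Y) n1 np alphaP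
  (iota_xin iota)); split.
- by rewrite [LHS]Xn /= map_scalar_mx rmorph_int.
- by rewrite [LHS]Yn /= map_scalar_mx rmorph_nat.
- by rewrite [LHS]YX /= map_scalar_mx.
Qed.
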